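(* Let $p,q$ be prime numbers (not necessarily distinct) with $q\leq p$ and $p\not\equiv 1\pmod q$, and let $B$ be a left cancellative left semi-brace such that $|B|=pq$. Let $E$ be the set of idempotents of $(B,+)$ and suppose that $|E|>1$. Then, up to isomorphism, $B$ is one of the following left semi-braces: 1) $(B,\circ)=\mathbb{Z}/p^2\mathbb{Z}$, $E=B$ and $a+b:=b$ for all $a,b\in B$ (where $p=q$); 2) $(B,\circ)=\mathbb{Z}/p\mathbb{Z}\times\mathbb{Z}/p\mathbb{Z}$, $E=B$ and $a+b:=b$ for all $a,b\in B$ (where $p=q$); 3) $(B,\circ)=\mathbb{Z}/p\mathbb{Z}\times\mathbb{Z}/q\mathbb{Z}$, $E=B$ and $a+b:=b$ for all $a,b\in B$ (where $p\neq q$); 4) $(B,\circ)=\mathbb{Z}/p\mathbb{Z}\times\mathbb{Z}/q\mathbb{Z}$, $E=\{0\}\times\mathbb{Z}/q\mathbb{Z}$ and $(a,b)+(c,d):=(a+c,d)$ for all $(a,b),(c,d)\in B$ (where $p\neq q$); 5) $(B,\circ)=\mathbb{Z}/q\mathbb{Z}\times\mathbb{Z}/p\mathbb{Z}$, $E=\{0\}\times\mathbb{Z}/p\mathbb{Z}$ and $(a,b)+(c,d):=(a+c,d)$ for all $(a,b),(c,d)\in B$ (where $p\neq q$); 6) $(B,\circ)=\mathbb{Z}/p\mathbb{Z}\times\mathbb{Z}/p\mathbb{Z}$, $E=\{0\}\times\mathbb{Z}/p\mathbb{Z}$ and $(a,b)+(c,d):=(a+c,d)$ for all $(a,b),(c,d)\in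 B$ (where $p=q$).
   Context: A left semi-brace is a triple $(B,+,\circ)$ where $(B,+)$ is a semigroup, $(B,\circ)$ is a group and $a\circ(b+c)=a\circ b+a\circ(a^-+c)$ for all $a,b,c\in B$, where $a^-$ is the inverse of $a$ in $(B,\circ)$ and $\circ$ has higher precedence than $+$. It is left cancellative if $(B,+)$ is left cancellative. Isomorphisms are bijections preserving both operations. In the list, $(B,\circ)=\mathbb{Z}/n\mathbb{Z}\times\cdots$ means that $\circ$ is the usual (componentwise) modular addition, and in the expression $(a+c,d)$ the symbol $+$ on the right-hand side is the usual modular addition. *)

(* Defs.v *)
From HB Require Import structures.
From mathcomp Require Import all_boot all_order all_algebra all_fingroup.

Set Implicit Arguments.
Unset Strict Implicit.
Unset Printing Implicit Defensive.

Import GroupScope.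

Reserved Notation "a ⊕ b" (at level 50, left associativity).

(* The group (B, o) is the multiplicative group structure of B; the semigroup
   law + is written ⊕ (it need not be commutative, so it is not the additive
   law of an nmodType), and the inverse a^- is a^-1. *)
HB.mixin Record Group_isLeftSemiBrace B of monoid.Group B := {
  sbadd : B -> B -> B;
  sbaddA : associative sbadd;
  sbadd_mulgDr : forall a b c : B,
    a * sbadd b c = sbadd (a * b) (a * sbadd a^-1 c)
}.

#[short(type="leftSemiBraceType")]
HB.structure Definition LeftSemiBrace :=
  {B of Group_isLeftSemiBrace B & monoid.Group B}.

#[short(type="finLeftSemiBraceType")]
HB.structure Definition FinLeftSemiBrace :=
  {B of Group_isLeftSemiBrace B & FinGroup B}.

Notation "a ⊕ b" := (sbadd a b) : group_scope.

Definition left_cancellative (B : leftSemiBraceType) : Prop :=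
  forall a b c : B, a ⊕ b = a ⊕ c -> b = c.

Definition sb_idempotents (B : finLeftSemiBraceType) : {set B} :=
  [set e : B | e ⊕ e == e].

Definition left_semi_brace_isomorphic (B C : leftSemiBraceType) : Prop :=
  exists f : B -> C,
    [/\ bijective f,
        {morph f : a b / a * b} &
        {morph f : a b / a ⊕ b}].

(* A group G with a + b := b. *)
Definition rightZeroSB (G : Type) : Type := G.

Section RightZeroSB.
Variable G : finGroupType.

HB.instance Definition _ := FinGroup.copy (rightZeroSB G) G.

Definition rightZeroSB_add (a b : rightZeroSB G) : rightZeroSB G := b.

Fact rightZeroSB_addA : associative rightZeroSB_add.
Proof. by []. Qed.

Fact rightZeroSB_mulgDr (a b c : rightZeroSB G) :
  a * rightZeroSB_add b c =
  rightZeroSB_add (a * b) (a * rightZeroSB_add a^-1 c).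
Proof. by []. Qed.

HB.instance Definition _ := Group_isLeftSemiBrace.Build (rightZeroSB G)
  rightZeroSB_addA rightZeroSB_mulgDr.

End RightZeroSB.

(* Z/m x Z/n with (a, b) + (c, d) := (a + c, d).  The multiplicative finite
   group structure of 'Z_m is modular addition, so that of 'Z_m * 'Z_n is
   componentwise modular addition.  As usual 'Z_n is Z/nZ only for n > 1. *)
Definition semiTrivialSB (m n : nat) : Type := ('Z_m * 'Z_n)%type.

Section SemiTrivialSB.
Variables m n : nat.

HB.instance Definition _ :=
  FinGroup.copy (semiTrivialSB m n) ('Z_m * 'Z_n)%type.

Definition semiTrivialSB_add (x y : semiTrivialSB m n) : semiTrivialSB m n :=
  ((x.1 + y.1)%R, y.2).

Fact semiTrivialSB_addA : associative semiTrivialSB_add.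
Proof.
by move=> x y z; rewrite /semiTrivialSB_add /= GRing.addrA.
Qed.

Fact semiTrivialSB_mulE (x y : semiTrivialSB m n) :
  x * y = ((x.1 + y.1)%R, (x.2 + y.2)%R).
Proof. by []. Qed.

Fact semiTrivialSB_mulgDr (a b c : semiTrivialSB m n) :
  a * semiTrivialSB_add b c =
  semiTrivialSB_add (a * b) (a * semiTrivialSB_add a^-1 c).
Proof.
rewrite !semiTrivialSB_mulE /semiTrivialSB_add /=; congr pair.
rewrite -GRing.addrA; congr (_ + (_ + _))%R.
by rewrite FinRing.zmodVgE GRing.addrA GRing.subrr GRing.add0r.
Qed.

HB.instance Definition _ := Group_isLeftSemiBrace.Build (semiTrivialSB m n)
  semiTrivialSB_addA semiTrivialSB_mulgDr.

End SemiTrivialSB.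

(* Main.v *)
(* The map lambda_a(b) = a (a^- + b) is an action of (B, o) by automorphisms of
   (B, +).  The set E of idempotents is the lambda-orbit of 1, on which the
   subgroup E of (B, o) acts regularly; the stabilizer G of 1 is a complement
   of E, and both operations restrict to G.  The arithmetic hypotheses force
   (B, o) to be abelian.  If E = B then + is the right zero law.  Otherwise
   |G| is prime, so lambda is trivial on G, while commutativity makes lambda
   trivial from G on E; hence (g e) + (h f) = (g h) f for g, h in G and
   e, f in E. *)
Require Import Defs.
From HB Require Import structures.
From mathcomp Require Import all_boot all_order all_algebra all_fingroup.
From mathcomp Require Import all_solvable.

Set Implicit Arguments.
Unset Strict Implicit.
Unset Printing Implicit Defensive.

Import GroupScope.

(** * Divisors of [p * q], and power maps from residues into finite groups *)

Lemma dvdn_mul_primes (p q d : nat) : prime p -> prime q -> d %| p * q ->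
  [\/ d = 1, d = p, d = q | d = p * q]%N.
Proof.
move=> pp pq ddv; case: (boolP (p %| d)) => [/dvdnP [k dE]|].
  move: ddv; rewrite dE mulnC dvdn_pmul2l ?prime_gt0 //.
  by case/(primeP pq).2/orP => /eqP->; [apply: Or42; rewrite muln1 | apply: Or44].
rewrite -prime_coprime // coprime_sym => cop.
move: ddv; rewrite Gauss_dvdr //.
by case/(primeP pq).2/orP => /eqP->; [apply: Or41 | apply: Or43].
Qed.

Lemma expg_Zp_morph (gT : finGroupType) (n : nat) (x : gT) : (1 < n)%N ->
  #[x] = n -> {morph (fun k : 'Z_n => x ^+ k) : a b / a * b >-> a * b}.
Proof.
move=> n1 xn a b; rewrite -expgD; apply/eqP; rewrite eq_expg_mod_order xn.
(* The underlying bound of ['Z_n] is [(Zp_trunc n).+2], which is [n] only because [1 < n]. *)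
have -> : val (a * b) = ((a + b) %% n)%N.
  by rewrite -[X in (_ %% X)%N](Zp_cast n1).
by rewrite modn_mod.
Qed.

Lemma expg_Zp_inj (gT : finGroupType) (n : nat) (x : gT) : (1 < n)%N ->
  #[x] = n -> injective (fun k : 'Z_n => x ^+ k).
Proof.
move=> n1 xn a b /eqP; rewrite eq_expg_mod_order xn => /eqP.
have ltn (c : 'Z_n) : (c < n)%N by rewrite -[X in (_ < X)%N](Zp_cast n1).
by rewrite !modn_small // => /val_inj.
Qed.

Lemma expg_Zp_bij (gT : finGroupType) (n : nat) (x : gT) : (1 < n)%N ->
  #[x] = n -> #|gT| = n -> bijective (fun k : 'Z_n => x ^+ k).
Proof.
move=> n1 xn cardG; apply: inj_card_bij; first exact: expg_Zp_inj.
by rewrite card_ord (Zp_cast n1) cardG.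
Qed.

Lemma expg2_Zp_morph (gT : finGroupType) (m n : nat) (x y : gT) :
  (1 < m)%N -> (1 < n)%N -> #[x] = m -> #[y] = n -> commute x y ->
  {morph (fun u : 'Z_m * 'Z_n => x ^+ u.1 * y ^+ u.2) : a b / a * b >-> a * b}.
Proof.
move=> m1 n1 xm yn cxy a b.
rewrite (expg_Zp_morph m1 xm a.1) (expg_Zp_morph n1 yn a.2).
have cxy' : commute (x ^+ b.1) (y ^+ a.2) by apply/commuteX2.
by rewrite -!mulgA; congr (_ * _); rewrite !mulgA; congr (_ * _).
Qed.

Lemma expg2_Zp_bij (gT : finGroupType) (m n : nat) (x y : gT) :
  (1 < m)%N -> (1 < n)%N -> #[x] = m -> #[y] = n ->
  <[x]> :&: <[y]> = 1 -> #|gT| = (m * n)%N ->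
  bijective (fun u : 'Z_m * 'Z_n => x ^+ u.1 * y ^+ u.2).
Proof.
move=> m1 n1 xm yn tixy cardG; apply: inj_card_bij; last first.
  by rewrite card_prod !card_ord !Zp_cast // cardG.
move=> [a b] [c d] /= eq_xy.
(* Powers of [x] are moved to one side and powers of [y] to the other: the common value lies in both
   cyclic groups, hence is 1. *)
have eq1 : (x ^+ c)^-1 * x ^+ a = y ^+ d * (y ^+ b)^-1.
  by apply: (mulgI (x ^+ c)); apply: (mulIg (y ^+ b)); rewrite mulKVg !mulgA mulgKV.
have : (x ^+ c)^-1 * x ^+ a \in <[x]> :&: <[y]>.
  rewrite inE {2}eq1 !groupM ?groupV ?mem_cycle //.
rewrite tixy => /set1P e1; move: eq1; rewrite e1 => e2.
have /(expg_Zp_inj m1 xm)-> : x ^+ a = x ^+ c.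
  by apply: (mulgI (x ^+ c)^-1); rewrite e1 mulVg.
by have /(expg_Zp_inj n1 yn)-> : y ^+ b = y ^+ d
  by apply: (mulIg (y ^+ b)^-1); rewrite -e2 mulgV.
Qed.

(** * Groups of order [p * q] *)

Lemma Sylow_normal_pq (gT : finGroupType) (p q : nat) (G : {group gT}) :
  prime p -> prime q -> p <> q -> #|G| = (p * q)%N -> q <> 1 %[mod p] ->
  exists P : {group gT}, [/\ p.-Sylow(G) P, P <| G & #|P| = p].
Proof.
move=> pp pq npq cardG nq1; have p1 := prime_gt1 pp.
have : #|'Syl_p(G)| == 1%N.
  (* The count divides [p * q] and is 1 modulo [p]: this rules out [p] and [p * q], and the
     hypothesis on [q] rules out [q]. *)
  have := card_Syl_dvd p G; have := card_Syl_mod G pp; rewrite cardG => md.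
  case/(dvdn_mul_primes pp pq) => cS; rewrite cS in md *.
  - by [].
  - by rewrite modnn in md.
  - by case: nq1; rewrite md modn_small.
  - by rewrite modnMr in md.
case/normal_sylowP => P sylP nP; exists P; split=> //.
rewrite (card_Hall sylP) cardG partnM ?prime_gt0 // part_pnat_id ?pnat_id //.
rewrite part_p'nat ?muln1 // pnatE // inE /= inE.
by apply/eqP => e; apply: npq.
Qed.

(** Order [p ^ 2] is the classical case. Otherwise [1 < q < p] gives [q <> 1 %[mod p]], so both
    Sylow subgroups are normal; they meet trivially, hence commute, and each is cyclic. *)
Lemma abelian_pq (gT : finGroupType) (p q : nat) (G : {group gT}) :
  prime p -> prime q -> (q <= p)%N -> p <> 1 %[mod q] -> #|G| = (p * q)%N ->
  abelian G.
Proof.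
move=> pp pq; rewrite leq_eqVlt => /predU1P[->|ltqp] np1 cardG.
  by apply: (@card_p2group_abelian _ p); rewrite ?cardG.
have npq : p <> q by move=> eqpq; rewrite eqpq ltnn in ltqp.
have nq1 : q <> 1 %[mod p].
  rewrite !modn_small ?prime_gt1 // => q1; by rewrite q1 in pq.
have [P [sylP nP cP]] := Sylow_normal_pq pp pq npq cardG nq1.
have [Q [sylQ nQ cQ]] :
    exists Q : {group gT}, [/\ q.-Sylow(G) Q, Q <| G & #|Q| = q].
  apply: (Sylow_normal_pq pq pp) => //; last by rewrite cardG mulnC.
  by move=> e; apply: npq.
have tiPQ : P :&: Q = 1.
  by rewrite coprime_TIg // cP cQ prime_coprime // dvdn_prime2 //; apply/eqP.
have <- : P * Q = G.
  apply/eqP; rewrite eqEcard mul_subG ?normal_sub //=.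
  by rewrite TI_cardMg // cardG cP cQ.
rewrite abelianM !cyclic_abelian ?prime_cyclic ?cP ?cQ //=.
rewrite centsC (sameP commG1P eqP) -subG1 -tiPQ commg_subI // subsetI subxx /=.
  exact: subset_trans (normal_sub nP) (normal_norm nQ).
exact: subset_trans (normal_sub nQ) (normal_norm nP).
Qed.

(** * Transport from the models, and their idempotents *)

Lemma sb_isomorphic_of_bij (B C : leftSemiBraceType) (f : C -> B) :
  bijective f -> {morph f : a b / a * b} -> {morph f : a b / a ⊕ b} ->
  left_semi_brace_isomorphic B C.
Proof.
case=> g fK gK fM fD; exists g; split; first by exists f.
  by move=> a b; rewrite -{1}(gK a) -{1}(gK b) -fM fK.
by move=> a b; rewrite -{1}(gK a) -{1}(gK b) -fD fK.
Qed.

Lemma sb_idempotents_rightZero (G : finGroupType) :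
  sb_idempotents (rightZeroSB G) = [set: G].
Proof. by apply/setP => e; rewrite !inE /=; apply/eqP. Qed.

Lemma sb_idempotents_semiTrivial (m n : nat) :
  sb_idempotents (semiTrivialSB m n) = setX [set 0%R] [set: 'Z_n].
Proof.
apply/setP => -[a b]; rewrite !inE andbT /=.
apply/eqP/eqP => [[/eqP]|->]; last by congr pair; rewrite GRing.addr0.
have -> : (Zp_add a a == a) = (a + a == a + 0)%R by rewrite GRing.addr0.
by move=> /eqP/GRing.addrI.
Qed.

(** * The lambda action, the subgroup of idempotents and the stabilizer of 1 *)

Section LeftCancellative.
Variable B : finLeftSemiBraceType.
Hypothesis cancB : left_cancellative B.

Implicit Types a b c e f g h : B.

Definition sb_lambda a b : B := a * (a^-1 ⊕ b).

Local Notation lam := sb_lambda.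
Local Notation E := (sb_idempotents B).

Lemma sb_mulD a b c : a * (b ⊕ c) = a * b ⊕ lam a c.
Proof. exact: sbadd_mulgDr. Qed.

(** At [a = b = 1] the compatibility law reads [1 ⊕ c = 1 ⊕ (1 ⊕ c)]; cancel the outer [1]. *)
Lemma sb_add1 c : 1 ⊕ c = c.
Proof.
by have := sb_mulD 1 1 c; rewrite /sb_lambda invg1 !mul1g => /cancB/esym.
Qed.

Lemma sb_lambda1 c : lam 1 c = c.
Proof. by rewrite /sb_lambda invg1 mul1g sb_add1. Qed.

Lemma sb_lambdaD a b c : lam a (b ⊕ c) = lam a b ⊕ lam a c.
Proof. by rewrite {1}/sb_lambda sbaddA sb_mulD. Qed.

(** The compatibility law turns [b * ((a * b)^-1 ⊕ c)] into [a^-1 ⊕ lam b c]. *)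
Lemma sb_lambdaM a b c : lam (a * b) c = lam a (lam b c).
Proof. by rewrite [LHS]/sb_lambda invgM -mulgA sb_mulD mulKVg. Qed.

Lemma sb_mulE a b : a * b = a ⊕ lam a b.
Proof. by rewrite -[in LHS](sb_add1 b) sb_mulD mulg1. Qed.

(** For idempotent [e], associativity gives [e ⊕ (e ⊕ x) = e ⊕ x], and [e] cancels. *)
Lemma sb_idemP e : reflect (forall x, e ⊕ x = x) (e \in E).
Proof.
rewrite inE; apply: (iffP eqP) => [ee x|->//].
by apply: (cancB (a := e)); rewrite sbaddA ee.
Qed.

Lemma sb_lambda_idem e x : e \in E -> lam e x = e * x.
Proof. by move/sb_idemP=> He; rewrite sb_mulE He. Qed.

Lemma sb_lambda_stable a e : e \in E -> lam a e \in E.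
Proof. by rewrite !inE -sb_lambdaD => /eqP->. Qed.

(** A product [e * f] of idempotents is [lam e f], and [lam e] preserves idempotence; finiteness
    provides inverses. *)
Lemma sb_idem_group_set : group_set E.
Proof.
apply/group_setP; split; first by apply/sb_idemP => x; rewrite sb_add1.
by move=> e f eE fE; rewrite -sb_lambda_idem // sb_lambda_stable.
Qed.

Definition sb_idem_group := Group sb_idem_group_set.

(* This is the additive group B + 1 of the literature: see sb_stab1P. *)
Definition sb_stab1 : {set B} := [set g | lam g 1 == 1].

Local Notation G := sb_stab1.

Lemma sb_stab1_group_set : group_set G.
Proof.
apply/group_setP; split; first by rewrite inE sb_lambda1.
by move=> g h; rewrite !inE sb_lambdaM => /eqP g1 /eqP->; apply/eqP.
Qed.

Definition sb_stab1_group := Group sb_stab1_group_set.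

Lemma sb_stab1P g : (g \in G) = (g ⊕ 1 == g).
Proof.
rewrite inE; apply/eqP/eqP => [g1|gg].
  by rewrite -[in LHS]g1 -sb_mulE mulg1.
by apply: (cancB (a := g)); rewrite -sb_mulE mulg1.
Qed.

Lemma sb_stab1_lambda g h : g \in G -> h \in G -> lam g h \in G.
Proof.
move=> gG; rewrite !sb_stab1P => /eqP h1; move: gG; rewrite inE => /eqP g1.
by rewrite -{1}g1 -sb_lambdaD h1.
Qed.

(** An idempotent [e] moves 1 to [lam e 1 = e]. *)
Lemma sb_idem_stab1_TI : E :&: G = 1.
Proof.
apply/(@trivgP _ (sb_idem_group :&: sb_stab1_group)%G)/subsetP => x.
rewrite inE => /andP[/sb_lambda_idem xE].
by rewrite inE xE mulg1 => /eqP->; rewrite inE.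
Qed.

Lemma sb_idem_mul_stab1 : E * G = [set: B].
Proof.
apply/setP => x; rewrite inE; apply/mulsgP.
(* The [E]-factor of [x] must be [lam x 1]: idempotents act by left multiplication, so dividing by
   it leaves an element fixing 1. *)
have xE : lam x 1 \in E by apply: sb_lambda_stable; apply: (group1 sb_idem_group).
exists (lam x 1) ((lam x 1)^-1 * x); rewrite ?mulKVg //.
have xE' : (lam x 1)^-1 \in E by apply: (groupVr (G := sb_idem_group)).
by rewrite inE sb_lambdaM (sb_lambda_idem _ xE') mulVg.
Qed.

Lemma sb_card : #|B| = (#|E| * #|G|)%N.
Proof.
rewrite -(TI_cardMg (G := sb_idem_group) (H := sb_stab1_group)) /=.
  by rewrite sb_idem_mul_stab1 cardsT.
exact: sb_idem_stab1_TI.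
Qed.

(** Library actions are right actions, whence the inverse on [a]. *)
Fact sb_lambda_is_action : is_action [set: B] (fun x a => lam a^-1 x).
Proof.
apply: is_total_action => [x|x a b]; first by rewrite invg1 sb_lambda1.
by rewrite invgM sb_lambdaM.
Qed.

Definition sb_lambda_act := Action sb_lambda_is_action.

(* The number of points of G fixed by the p-group G, |G| = p, is a multiple of
   p, and it is nonzero since 1 is fixed. *)
Lemma sb_lambda_trivial : prime #|G| -> {in G &, forall g h, lam g h = h}.
Proof.
move=> pG g h gG hG.
have actsG : [acts sb_stab1_group, on G | sb_lambda_act].
  rewrite /=; apply/subsetP => a aG; rewrite !inE; apply/subsetP => x xG.
  by rewrite inE sb_stab1_lambda ?(groupVr (G := sb_stab1_group)).
have pgG : #|G|.-group sb_stab1_group by rewrite /pgroup pnat_id.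
have one_fix : 1 \in 'Fix_(G | sb_lambda_act)(sb_stab1_group).
  rewrite inE (group1 sb_stab1_group); apply/afixP => a aG /=.
  by apply/eqP; have := groupVr (G := sb_stab1_group) aG; rewrite inE.
have := pgroup_fix_mod pgG actsG; rewrite modnn => /esym/eqP dvdF.
have leF : (#|G| <= #|'Fix_(G | sb_lambda_act)(sb_stab1_group)|)%N.
  by rewrite dvdn_leq //; apply/card_gt0P; exists 1.
have eqF : 'Fix_(G | sb_lambda_act)(sb_stab1_group) = G.
  by apply/eqP; rewrite eqEcard subsetIl leF.
have := hG; rewrite -eqF inE => /andP[_ /afixP /(_ g^-1)].
by rewrite /= invgK; apply; apply: (groupVr (G := sb_stab1_group)).
Qed.

Lemma sb_add_stab1_idem g h e f : prime #|G| -> abelian [set: B] ->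
  g \in G -> h \in G -> e \in E -> f \in E ->
  (g * e) ⊕ (h * f) = (g * h) * f.
Proof.
move=> pG abB gG hG eE fE.
have mulC (a b : B) : a * b = b * a by apply: (centsP abB); rewrite inE.
(* By commutativity [lam g' e' = lam (g' * e') 1 = lam e' (lam g' 1) = e']. *)
have geD (g' e' : B) : g' \in G -> e' \in E -> g' * e' = g' ⊕ e'.
  rewrite sb_mulE inE => /eqP g1 eE'; congr (_ ⊕ _).
  by rewrite -[e']mulg1 -[in LHS]sb_lambda_idem // -sb_lambdaM mulC
    sb_lambdaM g1 sb_lambda_idem.
rewrite (geD g e) // (geD h f) //.
rewrite (geD (g * h) f) ?(groupM (G := sb_stab1_group)) //.
(* Triviality of [lam] on [G] gives [g * h = g ⊕ h]; then [e] disappears as a left identity. *)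
rewrite (sb_mulE g h) sb_lambda_trivial // -!sbaddA; congr (_ ⊕ _).
by move/sb_idemP: eE.
Qed.

(** Exponents of generators of [G] and [E] serve as coordinates; [G] comes first, hence the order
    [s r]. *)
Lemma sb_iso_semiTrivial (r s : nat) : prime r -> prime s ->
  abelian [set: B] -> #|E| = r -> #|G| = s ->
  left_semi_brace_isomorphic B (semiTrivialSB s r).
Proof.
move=> pr ps abB cE cG.
have /cyclicP[e Ee] : cyclic sb_idem_group by rewrite prime_cyclic ?cE.
have /cyclicP[g Gg] : cyclic sb_stab1_group by rewrite prime_cyclic ?cG.
have /= Xe k : e ^+ k \in E by rewrite (groupX (G := sb_idem_group)) // Ee cycle_id.
have /= Xg k : g ^+ k \in G by rewrite (groupX (G := sb_stab1_group)) // Gg cycle_id.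
have oe : #[e] = r by rewrite orderE -Ee.
have og : #[g] = s by rewrite orderE -Gg.
have cge : commute g e by apply: (centsP abB); rewrite inE.
have s1 := prime_gt1 ps; have r1 := prime_gt1 pr.
apply: (@sb_isomorphic_of_bij _ (semiTrivialSB s r)
          (fun u : 'Z_s * 'Z_r => g ^+ u.1 * e ^+ u.2)).
- by apply: expg2_Zp_bij => //; rewrite -?Ee -?Gg 1?setIC ?sb_idem_stab1_TI //
    sb_card cE cG mulnC.
- exact: expg2_Zp_morph.
move=> u v; rewrite sb_add_stab1_idem ?cG //.
by rewrite -(expg_Zp_morph s1 og).
Qed.

(** When [E] fills [B] every element is a left identity, so any group isomorphism respects [⊕]. *)
Lemma sb_iso_rightZero (H : finGroupType) (f : H -> B) : #|E| = #|B| ->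
  bijective f -> {morph f : a b / a * b} ->
  left_semi_brace_isomorphic B (rightZeroSB H).
Proof.
move=> cE bf fM; apply: (@sb_isomorphic_of_bij _ (rightZeroSB H) f) => // a b.
have -> : a ⊕ b = b by [].
have /sb_idemP -> // : f a \in E.
have -> : E = [set: B] by apply/eqP; rewrite eqEcard subsetT cardsT cE /=.
by rewrite inE.
Qed.

End LeftCancellative.

(** * Classification by the order of the idempotent subgroup *)

Theorem theorem4p3 (p q : nat) (B : finLeftSemiBraceType) :
  prime p -> prime q -> (q <= p)%N -> p <> 1 %[mod q] ->
  left_cancellative B -> #|B| = (p * q)%N -> (1 < #|sb_idempotents B|)%N ->
  [/\ p = q,
      left_semi_brace_isomorphic B (rightZeroSB 'Z_(p ^ 2)) &
      sb_idempotents (rightZeroSB 'Z_(p ^ 2)) = [set: 'Z_(p ^ 2)]] \/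
  [/\ p = q,
      left_semi_brace_isomorphic B (rightZeroSB ('Z_p * 'Z_p)) &
      sb_idempotents (rightZeroSB ('Z_p * 'Z_p)) = [set: 'Z_p * 'Z_p]] \/
  [/\ p <> q,
      left_semi_brace_isomorphic B (rightZeroSB ('Z_p * 'Z_q)) &
      sb_idempotents (rightZeroSB ('Z_p * 'Z_q)) = [set: 'Z_p * 'Z_q]] \/
  [/\ p <> q,
      left_semi_brace_isomorphic B (semiTrivialSB p q) &
      sb_idempotents (semiTrivialSB p q) = setX [set 0%R] [set: 'Z_q]] \/
  [/\ p <> q,
      left_semi_brace_isomorphic B (semiTrivialSB q p) &
      sb_idempotents (semiTrivialSB q p) = setX [set 0%R] [set: 'Z_p]] \/
  [/\ p = q,
      left_semi_brace_isomorphic B (semiTrivialSB p p) &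
      sb_idempotents (semiTrivialSB p p) = setX [set 0%R] [set: 'Z_p]].
Proof.
move=> pp pq leqp np1 cancB cB E1.
have abB : abelian [set: B] by rewrite (abelian_pq pp pq) ?cardsT.
have p1 := prime_gt1 pp; have q1 := prime_gt1 pq.
have cEG := sb_card cancB; rewrite cB in cEG.
have := dvdn_mulr #|sb_stab1 B| (dvdnn #|sb_idempotents B|); rewrite -cEG.
(* Order 1 is excluded, a prime order leaves a stabilizer of prime order, and [p * q] means [E = B].
   If [p = q], both prime cases give the sixth family. *)
case/(dvdn_mul_primes pp pq) => cE.
- by rewrite cE in E1.
- have cG : #|sb_stab1 B| = q.
    by apply/eqP; rewrite -(eqn_pmul2l (prime_gt0 pp)) cEG cE.
  have isoB := sb_iso_semiTrivial cancB pp pq abB cE cG.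
  have [eqpq|/eqP npq] := eqVneq p q.
    by rewrite -eqpq in isoB; do 5!right; split; rewrite ?sb_idempotents_semiTrivial.
  by do 4!right; left; rewrite sb_idempotents_semiTrivial.
- have cG : #|sb_stab1 B| = p.
    by apply/eqP; rewrite -(eqn_pmul2l (prime_gt0 pq)) -cE -cEG cE mulnC.
  have isoB := sb_iso_semiTrivial cancB pq pp abB cE cG.
  have [eqpq|/eqP npq] := eqVneq p q.
    by rewrite -eqpq in isoB; do 5!right; split; rewrite ?sb_idempotents_semiTrivial.
  by do 3!right; left; rewrite sb_idempotents_semiTrivial.
have cEB : #|sb_idempotents B| = #|B| by rewrite cE cB.
rewrite !sb_idempotents_rightZero.
have [eqpq|/eqP npq] := eqVneq p q.
  rewrite -eqpq in cB *.
  have p2 : (1 < p ^ 2)%N by rewrite (ltn_exp2l 0).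
  (* An element of order [p ^ 2] makes the group cyclic; without one, every nontrivial element has
     order [p]. *)
  have [/existsP[x /eqP ox]|/existsPn nox] := boolP [exists x : B, #[x] == (p ^ 2)%N].
    left; split=> //; apply: (sb_iso_rightZero cancB cEB (expg_Zp_bij p2 ox _)).
      by rewrite cB mulnn.
    exact: expg_Zp_morph.
  have op (x : B) : x != 1 -> #[x] = p.
    move=> nx1; have := order_dvdG (in_setT x); rewrite cardsT cB.
    case/(dvdn_mul_primes pp pp) => // ox; first by rewrite -order_eq1 ox in nx1.
    by have := nox x; rewrite ox mulnn eqxx.
  have [x nx1] : exists x : B, x != 1.
    have : (1 < #|[set: B]|)%N by rewrite cardsT cB -[1%N]muln1 ltn_mul.
    by rewrite cardG_gt1 => /trivgPn[x _ nx1]; exists x.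
  have [y yx] : exists y, y \notin <[x]>.
    apply/existsP; rewrite -negb_forall; apply/negP => /forallP all_x.
    have : (#|B| <= #[x])%N by rewrite -cardsT subset_leq_card //; apply/subsetP.
    by rewrite op // cB leqNgt ltn_Pmulr // prime_gt0.
  have oy : #[y] = p by apply: op; apply: contraNneq yx => ->; apply: group1.
  have tixy : <[x]> :&: <[y]> = 1.
    (* [<[y]>] has prime order and is not contained in [<[x]>]. *)
    by rewrite setIC prime_TIg ?cycle_subG // -orderE oy.
  have cxy : commute x y by apply: (centsP abB); rewrite inE.
  right; left; split=> //.
  apply: (sb_iso_rightZero cancB cEB (expg2_Zp_bij p1 p1 (op x nx1) oy tixy cB)).
  exact: expg2_Zp_morph (op x nx1) oy cxy.
have [x _ ox] : {x | x \in [set: B] & #[x] = p}.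
  by apply: Cauchy; rewrite // cardsT cB dvdn_mulr.
have [y _ oy] : {y | y \in [set: B] & #[y] = q}.
  by apply: Cauchy; rewrite // cardsT cB dvdn_mull.
have tixy : <[x]> :&: <[y]> = 1.
  by rewrite coprime_TIg // -!orderE ox oy prime_coprime // dvdn_prime2 //; apply/eqP.
have cxy : commute x y by apply: (centsP abB); rewrite inE.
do 2!right; left; split=> //.
apply: (sb_iso_rightZero cancB cEB (expg2_Zp_bij p1 q1 ox oy tixy cB)).
exact: expg2_Zp_morph ox oy cxy.
Qed.
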